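(* Let $H$ be a finite hypergraph as in the context and $x(n)$ the Pólya urn process on $H$. There exists a closed connected set $\mathscr J=\mathscr J(H)\subset\Delta^{m-1}$ contained in an affine subspace of $\mathbb R^m$ such that, almost surely, the limit set of $(x(n))_{n\ge0}$ (its set of accumulation points) is contained in $\mathscr J$. Moreover, if almost surely the limit set of $x(n)$ does not intersect $\partial\Delta^{m-1}=\{x\in\Delta^{m-1}:x_i=0\text{ for some } i\}$, then $x(n)$ converges almost surely to a (random) point of $\mathscr J$.
   Context: Let $H=(V,E)$ be a finite hypergraph with vertex set $V=[m]=\{1,\dots,m\}$ and a set $E$ of $N\ge 1$ hyperedges (nonempty subsets of $[m]$), such that every vertex belongs to at least one hyperedge. Pólya urn on $H$: initially vertex $i$ holds $B_i(0)\ge 1$ balls; $N_0=\sum_{i=1}^m B_i(0)$. At each step $n\ge 1$, for each hyperedge $I\in E$ (independently across hyperedges, conditionally on the past) one ball is added to a vertex $i\in I$ chosen with probability $B_i(n-1)/\sum_{j\in I}B_j(n-1)$, where $B_i(n)$ denotes the number of balls at vertex $i$ after step $n$. Put $x_i(n)=B_i(n)/(N_0+nN)$ and $x(n)=(x_1(n),\dots,x_m(n))$. $\Delta^{m-1}=\{x\in\mathbb R^m: x_i\ge 0,\ \sum_i x_i=1\}$. *)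

(* Defs.v *)
From HB Require Import structures.
From mathcomp Require Import all_boot all_order all_algebra.
From mathcomp Require Import all_classical all_reals all_analysis.
Set Implicit Arguments. Unset Strict Implicit. Unset Printing Implicit Defensive.
Import Order.TTheory GRing.Theory Num.Theory.
Import numFieldNormedType.Exports.
Local Open Scope classical_set_scope.
Local Open Scope ring_scope.

(* A finite hypergraph on the vertex set 'I_m ({1,..,m} shifted to {0,..,m-1})
   with N hyperedges, indexed by 'I_N : e k is the k-th hyperedge.
   Hyperedges are pairwise distinct (E is a set), nonempty, N >= 1,
   and every vertex belongs to at least one hyperedge. *)
Definition hypergraph_ok (m N : nat) (e : 'I_N -> {set 'I_m}) : Prop :=
  [/\ (0 < N)%N, injective e, (forall k, e k != finset.set0)
    & (forall i : 'I_m, exists k, i \in e k)].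

(* One-step transition probability of the ball-count vector from b to b':
   for each hyperedge e k independently, a vertex c k in e k is chosen with
   probability b (c k) / sum_{j in e k} b j and receives one ball. *)
Definition urn_step {R : realType} (m N : nat) (e : 'I_N -> {set 'I_m})
  (b b' : 'I_m -> nat) : R :=
  \sum_(c : {ffun 'I_N -> 'I_m} |
          [forall k, c k \in e k] &&
          [forall i, b' i == (b i + #|[set k | c k == i]|)%N])
     \prod_(k : 'I_N) ((b (c k))%:R / (\sum_(j in e k) (b j)%:R)).

(* B is (the law of) the Polya urn process on the hypergraph e with initial
   ball counts b0: B 0 = b0 a.s., and its finite-dimensional distributions are
   those of the Markov chain with transition probabilities urn_step. *)
Definition polya_urn_process {R : realType} {d : measure_display}
  {T : measurableType d} (P : probability T R) (m N : nat)
  (e : 'I_N -> {set 'I_m}) (b0 : 'I_m -> nat)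
  (B : nat -> T -> 'I_m -> nat) : Prop :=
  [/\ (forall n (b : 'I_m -> nat), measurable [set t | forall i, B n t i = b i]),
      P [set t | forall i, B 0%N t i = b0 i] = 1%E
    & forall n (h : nat -> 'I_m -> nat) (b' : 'I_m -> nat),
        P [set t | (forall k, (k <= n)%N -> forall i, B k t i = h k i)
                   /\ forall i, B n.+1 t i = b' i]
        = (P [set t | forall k, (k <= n)%N -> forall i, B k t i = h k i]
           * (urn_step e (h n) b')%:E)%E].

Definition urn_proportion {R : realType} (m N : nat) (b0 : 'I_m -> nat)
  (Bn : 'I_m -> nat) (n : nat) : 'rV[R]_m :=
  \row_i ((Bn i)%:R / ((\sum_j b0 j) + n * N)%:R).

Definition simplex {R : realType} (m : nat) : set 'rV[R]_m :=
  [set x | (forall i, 0 <= x ord0 i) /\ \sum_i x ord0 i = 1].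

Definition simplex_boundary {R : realType} (m : nat) : set 'rV[R]_m :=
  [set x | simplex x /\ exists i, x ord0 i = 0].

Definition affine_subspace {R : realType} (m : nat) (A : set 'rV[R]_m) : Prop :=
  (exists a, A a) /\
  forall x y (t : R), A x -> A y -> A (t *: x + (1 - t) *: y).

Definition limit_set {T : topologicalType} (u : nat -> T) : set T :=
  [set y | forall U, nbhs y U -> forall n0, exists2 n, (n0 <= n)%N & U (u n)].

(* Main.v *)
Require Import Defs.
From HB Require Import structures.
From mathcomp Require Import all_boot all_order all_algebra.
From mathcomp Require Import all_classical all_reals all_analysis.
From mathcomp Require Import ring lra.
Import Order.TTheory GRing.Theory Num.Theory.
Import numFieldNormedType.Exports.
Local Open Scope classical_set_scope.
Local Open Scope ring_scope.
Set Implicit Arguments. Unset Strict Implicit. Unset Printing Implicit Defensive.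

(* Let S_I(x) = sum_(i in I) x_i and let w0 maximise prod_I S_I on the simplex.
   By strict AM-GM, J = {x in the simplex : S_I(x) = S_I(w0) for all I} is the
   set of all maximisers. For w in J, AM-GM also gives
     drift(b) = sum_I S_I(w) / S_I(b) - N / sum_i b_i >= 0,
   and from ln (b + xi) - ln b >= xi / b - N (1/b - 1/(b + xi)) for
   0 <= xi <= N it follows that
     - sum_i w_i ln x_i(n) + N sum_i w_i / B_i(n) + sum_(k < n) drift(B(k))
   is exactly a nonnegative supermartingale, hence converges almost surely. The
   expression is affine in w, so finitely many w spanning J suffice to get that
   almost surely sum_i w_i ln x_i(n) converges for all w in J. As the drifts are
   summable and of order 1/n times the AM-GM gap, x(n) has an accumulation point
   y in J; the relative entropy of x(n) to this random y then converges, and to 0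
   along a subsequence, so x(n) -> y. *)

(** * Supermartingales on histories *)

Lemma measure_le_sum_cover (R : realType) (d : measure_display)
    (T : measurableType d) (P : {measure set T -> \bar R}) (I : Type)
    (r : seq I) (F : I -> set T) (A : set T) :
  (forall i, measurable (F i)) -> measurable A ->
  A `<=` \big[setU/set0]_(i <- r) F i -> (P A <= \sum_(i <- r) P (F i))%E.
Proof.
move=> mF mA AF.
have mU s : measurable (\big[setU/set0]_(i <- s) F i).
  by elim/big_ind : _ => // ? ?; exact: measurableU.
apply: (@le_trans _ _ (P (\big[setU/set0]_(i <- r) F i))).
  by apply: le_measure; rewrite ?inE.
elim: r {AF} => [|i r IH]; first by rewrite !big_nil measure0.
rewrite !big_cons; apply: (le_trans (measureU2 _ (mF i) (mU r))).
exact: leeD.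
Qed.


(** * Upcrossings of a real sequence *)

Lemma first_occurrence (Q : pred nat) (n : nat) :
  (exists2 m, (n < m)%N & Q m) ->
  exists m, [/\ (n <= m)%N, Q m.+1 & forall i, (n < i <= m)%N -> ~~ Q i].
Proof.
move=> [m nm Qm]; have ex : exists m, (n < m)%N && Q m by exists m; rewrite nm.
case: (ex_minnP ex) => -[//|k] /andP[nk Qk] mink.
exists k; split=> // i /andP[ni ik]; apply/negP => Qi.
by have := mink i; rewrite ni Qi => /(_ isT); rewrite ltnNge ik.
Qed.

(* The flag is set while the path, having been at most [a], has not yet reached
   [b] again; the counter is the number of completed upcrossings of [a, b]. *)
Definition upcross_step (R : numDomainType) (a b v : R) (p : bool * nat) :=
  if p.1 then (if b <= v then (false, p.2.+1) else (true, p.2))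
  else (if v <= a then (true, p.2) else (false, p.2)).

(** From either value of the flag, the first later time at which the awaited level is met flips it,
    and every return to [false] completes an upcrossing. The flag is down at the chosen [n], so that
    no open position enters the wealth there. *)
Lemma upcrossings_unbounded (R : realDomainType) (a b : R) (v : nat -> R)
    (p : nat -> bool * nat) :
  (forall n, p n.+1 = upcross_step a b (v n.+1) (p n)) ->
  (forall n, exists2 m, (n < m)%N & v m <= a) ->
  (forall n, exists2 m, (n < m)%N & b <= v m) ->
  forall K, exists n, p n = (false, (p n).2) /\ (K <= (p n).2)%N.
Proof.
move=> pS va vb.
have stay n (Q : pred nat) x : (forall i, ~~ Q i ->
    upcross_step a b (v i) x = x) -> p n = x -> forall m, (n <= m)%N ->
    (forall i, (n < i <= m)%N -> ~~ Q i) -> p m = x.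
  move=> Qx pn; elim=> [|m IH]; first by rewrite leqn0 => /eqP <-.
  rewrite leq_eqVlt => /predU1P[<-//|]; rewrite ltnS => nm nQ.
  rewrite pS IH// ?Qx//; first by apply: nQ; rewrite ltnS nm leqnn.
  by move=> i /andP[ni im]; apply: nQ; rewrite ni ltnW.
have up n k : p n = (true, k) -> exists n', p n' = (false, k.+1).
  move=> pn; have [m [nm bm lt_b]] := first_occurrence (vb n).
  exists m.+1; rewrite pS (stay n (fun i => b <= v i) (true, k))//.
    by rewrite /upcross_step/= bm.
  by move=> i /negbTE; rewrite /upcross_step/= => ->.
have down n k : p n = (false, k) -> exists n', p n' = (true, k).
  move=> pn; have [m [nm am gt_a]] := first_occurrence (va n).
  exists m.+1; rewrite pS (stay n (fun i => v i <= a) (false, k))//.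
    by rewrite /upcross_step/= am.
  by move=> i /negbTE; rewrite /upcross_step/= => ->.
elim=> [|K [n [pn Kn]]].
  case p0: (p 0%N) => [[] k]; last by exists 0%N; rewrite p0.
  by have [n pn] := up _ _ p0; exists n; rewrite pn.
have [n1 pn1] := down _ _ pn; have [n2 pn2] := up _ _ pn1.
by exists n2; rewrite pn2.
Qed.

(** Compactness gives a cluster point [l >= 0]. If [v] does not tend to [l], then for some [e] it is
    infinitely often above [l + e] or infinitely often below [l - e], while it keeps returning near
    [l]; so it crosses an interval with positive rational endpoints infinitely often. *)
Lemma cvg_of_no_crossing (R : realType) (v : nat -> R) (K : R) :
  (forall n, 0 <= v n <= K) ->
  (forall q1 q2 : rat, 0 < q1 -> q1 < q2 ->
     ~ ((forall n, exists2 m, (n < m)%N & v m <= ratr q1) /\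
        (forall n, exists2 m, (n < m)%N & ratr q2 <= v m))) ->
  exists l : R, v @ \oo --> l.
Proof.
move=> vK cross.
have [l [_ cl]] : exists l : R, (`[0, K]%classic `&` cluster (v @ \oo)) l.
  apply: (segment_compact (a := 0) (b := K)); exists 0%N => // n _ /=.
  by rewrite in_itv/= vK.
have near_l (e : R) n : 0 < e -> exists2 m, (n < m)%N & `|v m - l| < e.
  move=> e0; have [] := cl [set v m | m in [set m | (n < m)%N]] (ball l e).
  - by exists n.+1 => // m /= nm; exists m.
  - exact: (@nbhsx_ballx _ R l e e0).
  by move=> _ [[m /= nm <-] lm]; exists m => //; rewrite distrC.
have l0 : 0 <= l.
  apply/ler_addgt0Pr => e e0; have [m _] := near_l e 0%N e0.
  by have /andP[] := vK m; rewrite ltr_norml; lra.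
exists l; apply/cvgrPdist_lt => e e0; apply: contrapT => far.
have {}far n : exists2 m, (n < m)%N & e <= `|l - v m|.
  apply: contrapT => close; apply: far; exists n.+1 => // m /= nm.
  by rewrite ltNge; apply/negP => em; apply: close; exists m.
have ratI (x y : R) : 0 <= x -> x < y ->
    exists q1 q2 : rat, [/\ 0 < q1, q1 < q2, x < ratr q1 & ratr q2 < y].
  move=> x0 xy; have [q1 /andP[xq1 q1y]] := rat_in_itvoo xy.
  have [q2 /andP[q12 q2y]] := rat_in_itvoo q1y; exists q1, q2; split=> //.
    by rewrite -(ltr_rat R) rmorph0 (le_lt_trans x0 xq1).
  by rewrite -(ltr_rat R).
have [high|/existsNP[n0 nhigh]] :=
  pselect (forall n, exists2 m, (n < m)%N & l + e <= v m).
  have le : l < l + e by rewrite ltrDl.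
  have [q1 [q2 [q10 q12 lq1 q2e]]] := ratI _ _ l0 le.
  apply: (cross q1 q2 q10 q12); split=> n.
    have [|m nm] := near_l (ratr q1 - l) n; first by rewrite subr_gt0.
    by rewrite ltr_norml => /andP[_ h]; exists m => //; lra.
  by have [m nm hm] := high n; exists m => //; lra.
have low n : exists2 m, (n < m)%N & v m <= l - e.
  have [m] := far (maxn n n0); rewrite gtn_max => /andP[nm n0m] em.
  exists m => //; have : ~ (l + e <= v m) by move=> h; apply: nhigh; exists m.
  move=> /negP; rewrite -ltNge => lte; move: em; rewrite ler_normr.
  by case/orP; lra.
(* A nonnegative value at most [l - e] shows [0 <= l - e], so that [ratI] provides positive
   rationals between [l - e] and [l]. *)
have [m0 _ vm0] := low 0%N; have /andP[v0 _] := vK m0.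
have [||q1 [q2 [q10 q12 lq1 q2e]]] := ratI (l - e) l; [lra|lra|].
apply: (cross q1 q2 q10 q12); split=> n.
  by have [m nm hm] := low n; exists m => //; lra.
have [|m nm] := near_l (l - ratr q2) n; first by rewrite subr_gt0.
by rewrite ltr_norml => /andP[h _]; exists m => //; lra.
Qed.

(** * Nonnegative supermartingales of a history process *)

Section HistoryProcess.
Variables (R : realType) (d : measure_display) (T : measurableType d).
Variables (P : probability T R) (S : countType) (C : finType).
Variables (nxt : seq S -> C -> S) (pr : seq S -> C -> R) (good : pred (seq S)).
Variable H : nat -> T -> seq S.
Hypothesis H_meas : forall n hs, measurable [set t | H n t = hs].
Hypothesis H_cons : forall n t, exists s, H n.+1 t = s :: H n t.
Hypothesis H_step : forall n hs s, P [set t | H n.+1 t = s :: hs] =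
  (P [set t | H n t = hs] * (\sum_(c | nxt hs c == s) pr hs c)%:E)%E.
Hypothesis pr_ge0 : forall hs c, good hs -> 0 <= pr hs c.
Hypothesis pr_sum : forall hs, good hs -> \sum_c pr hs c = 1.
Hypothesis good_nxt : forall hs c, good hs -> good (nxt hs c :: hs).

(** Histories are lists of states, newest first. There are countably many, so conditioning on the
    past means conditioning on the events [H n t = hs], and conditional expectations are finite sums
    over the choices [c]. The inequality is required on [good] histories, where [pr] is a
    probability. *)
Definition supermartingale (V : seq S -> R) :=
  forall hs, good hs -> \sum_c pr hs c * V (nxt hs c :: hs) <= V hs.

Lemma measurable_history n (Q : set (seq S)) : measurable [set t | Q (H n t)].
Proof.
rewrite (_ : mkset _ = \bigcup_hs ([set t | H n t = hs] `&` [set _ | Q hs])).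
  apply: (countable_bigcupT_measurable (countableP _)) => hs.
  apply: measurableI => //.
  have [q|nq] := pselect (Q hs).
    by rewrite (_ : [set _ | Q hs] = setT)//; apply/seteqP; split.
  by rewrite (_ : [set _ | Q hs] = set0)//; apply/seteqP; split.
apply/seteqP; split=> t /=; first by move=> q; exists (H n t).
by move=> [hs _ [<-]].
Qed.

Definition hits (V : seq S -> R) (lam : R) (n M : nat) : set T :=
  [set t | exists2 k, (k <= M)%N & lam <= V (H (n + k)%N t)].

Lemma measurable_hits V lam n M : measurable (hits V lam n M).
Proof.
rewrite (_ : hits _ _ _ _ = \bigcup_(k in [set k | (k <= M)%N])
    [set t | [set h | lam <= V h] (H (n + k)%N t)]).
  by apply: bigcup_measurable => k _; exact: measurable_history.
by apply/seteqP; split=> t [k kM Qk]; exists k.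
Qed.

(** A state that is no [nxt hs c] has an empty sum in [H_step], hence probability 0, and there are
    only countably many states. *)
Lemma history_off_support n hs :
  P ([set t | H n t = hs] `&`
     [set t | forall c, H n.+1 t <> nxt hs c :: hs]) = 0%E.
Proof.
set A := _ `&` _.
have mA : measurable A.
  apply: measurableI => //.
  exact: (@measurable_history n.+1 [set h | forall c, h <> nxt hs c :: hs]).
apply/(negligibleP _ mA).
pose F k := if @unpickle S k is Some s then
  [set t | H n.+1 t = s :: hs] `&` [set _ | forall c, s <> nxt hs c] else set0.
apply: (@negligibleS _ _ _ _ (\bigcup_k F k)) => [t [/= ht hc]|].
  have [s sE] := H_cons n t; exists (pickle s) => //.
  rewrite /F pickleK; split=> /=; first by rewrite sE ht.
  by move=> c sc; apply: (hc c); rewrite sE ht sc.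
apply: negligible_bigcup => k; rewrite /F.
case: unpickle => [s|]; last exact: negligible_set0.
have [hc|hc] := pselect (forall c, s <> nxt hs c).
  apply: (@negligibleS _ _ _ _ [set t | H n.+1 t = s :: hs]); first by move=> t [].
  have P0 : P [set t | H n.+1 t = s :: hs] = 0%E.
    by rewrite H_step big1 ?mule0// => c /eqP /esym /hc.
  exact/(negligibleP _ (H_meas _ _)).
rewrite (_ : _ `&` _ = set0); first exact: negligible_set0.
by apply/seteqP; split=> t // [].
Qed.


(* Ville's inequality, by induction on the horizon [M] over all starting
   histories: condition on the first step only. *)
Lemma ville_from (V : seq S -> R) (lam : R) : 0 < lam ->
  supermartingale V -> (forall hs, good hs -> 0 <= V hs) ->
  forall M n hs, good hs ->
  (P ([set t | H n t = hs] `&` hits V lam n M)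
   <= P [set t | H n t = hs] * (V hs / lam)%:E)%E.
Proof.
move=> lam0 sV V0 M n hs ghs.
have mB k q M' : measurable ([set t | H k t = q] `&` hits V lam k M').
  by apply: measurableI => //; exact: measurable_hits.
elim: M n hs ghs => [|M IH] n hs ghs; have [lV|Vl] := leP lam (V hs).
- apply: (@le_trans _ _ (P [set t | H n t = hs])).
    by apply: le_measure; rewrite ?inE//; exact: subIsetl.
  by rewrite -[leLHS]mule1 lee_pmul// lee_fin ler_pdivlMr// mul1r.
- rewrite (_ : _ `&` _ = set0) ?measure0; last first.
    apply/seteqP; split=> t // [/= ht [k]]; rewrite leqn0 => /eqP ->.
    by rewrite addn0 ht leNgt Vl.
  by rewrite mule_ge0// lee_fin divr_ge0// ?V0// ltW.
- apply: (@le_trans _ _ (P [set t | H n t = hs])).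
    by apply: le_measure; rewrite ?inE//; exact: subIsetl.
  by rewrite -[leLHS]mule1 lee_pmul// lee_fin ler_pdivlMr// mul1r.
(* Different choices may lead to the same state; removing duplicates counts each next history
   once. *)
pose r := undup (codom (nxt hs)).
pose F s := [set t | H n.+1 t = s :: hs] `&` hits V lam n.+1 M.
pose Z := [set t | H n t = hs] `&`
     [set t | forall c, H n.+1 t <> nxt hs c :: hs].
have mZ : measurable Z.
  apply: measurableI => //.
  exact: (@measurable_history n.+1 [set h | forall c, h <> nxt hs c :: hs]).
have mU : measurable (\big[setU/set0]_(s <- r) F s).
  by elim/big_ind : _ => // [? ?|s _]; [exact: measurableU|exact: mB].
apply: (@le_trans _ _ (P (Z `|` \big[setU/set0]_(s <- r) F s))).
  apply: le_measure; rewrite ?inE; [exact: mB|exact: measurableU|].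
  move=> t [/= ht [k kM Vk]].
  have [hc|/existsNP[c /contrapT hc]] :=
    pselect (forall c, H n.+1 t <> nxt hs c :: hs); first by left.
  right; rewrite -bigcup_seq; exists (nxt hs c).
    by rewrite /= mem_undup codom_f.
  split=> //=; case: k kM Vk => [|k] kM Vk.
    by move: Vk; rewrite addn0 ht leNgt Vl.
  by exists k => //; rewrite addSnnS.
apply: le_trans (measureU2 P mZ mU) _.
rewrite [X in (X + _)%E](_ : _ = 0%E) ?add0e; last exact: history_off_support.
apply: (@le_trans _ _ (\sum_(s <- r) P (F s))%E).
  by apply: measure_le_sum_cover => // s; exact: mB.
apply: (@le_trans _ _ (\sum_(s <- r) P [set t | H n t = hs] *
   ((\sum_(c | nxt hs c == s) pr hs c) * (V (s :: hs) / lam))%:E)%E).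
  rewrite big_seq [leRHS]big_seq; apply: lee_sum => s.
  rewrite mem_undup => /codomP[c ->].
  apply: le_trans (IH _ _ (good_nxt c ghs)) _.
  by rewrite H_step -muleA -EFinM.
have Pf : P [set t | H n t = hs] \is a fin_num by exact: fin_num_measure.
rewrite -(fineK Pf); under eq_bigr do rewrite -EFinM.
rewrite sumEFin -EFinM lee_fin -mulr_sumr ler_wpM2l ?fine_ge0//.
rewrite ler_pdivlMr// mulr_suml; apply: le_trans (sV _ ghs).
under eq_bigr do rewrite -mulrA divfK ?gt_eqF// mulr_suml big_mkcond/=.
rewrite exchange_big/=; apply: ler_sum => c _.
rewrite (bigD1_seq (nxt hs c)) ?undup_uniq ?mem_undup ?codom_f//= eqxx.
rewrite big1 ?addr0// => s.
by rewrite eq_sym => /negbTE ->.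
Qed.

Variable h0 : seq S.
Hypothesis good_h0 : good h0.
Hypothesis H0 : P [set t | H 0%N t = h0] = 1%E.

Lemma ville (V : seq S -> R) (lam : R) : 0 < lam -> supermartingale V ->
  (forall hs, good hs -> 0 <= V hs) ->
  (P (\bigcup_M hits V lam 0 M) <= (V h0 / lam)%:E)%E.
Proof.
move=> lam0 sV V0.
have VM M : (P (hits V lam 0 M) <= (V h0 / lam)%:E)%E.
  pose E := [set t | H 0%N t = h0].
  have mE : measurable E by exact: H_meas.
  have mhE : measurable (E `&` hits V lam 0 M).
    by apply: measurableI => //; exact: measurable_hits.
  apply: (@le_trans _ _ (P (E `&` hits V lam 0 M))).
    apply: (@le_trans _ _ (P (~` E `|` (E `&` hits V lam 0 M)))).
      apply: le_measure; rewrite ?inE; first exact: measurable_hits.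
        by apply: measurableU => //; exact: measurableC.
      by move=> t ht; have [tE|] := pselect (E t); [right|left].
    apply: le_trans (measureU2 P (measurableC mE) mhE) _.
    rewrite [X in (X + _)%E](_ : _ = 0%E) ?add0e//.
    have PE : P (~` E) = 0%E by rewrite probability_setC// /E H0 subee.
    exact: PE.
  apply: le_trans (ville_from lam0 sV V0 M 0%N good_h0) _.
  rewrite -[leRHS]mul1e lee_wpmul2r ?probability_le1//.
  by rewrite lee_fin divr_ge0// ?V0// ltW.
have cV : P (hits V lam 0 M) @[M --> \oo] --> P (\bigcup_M hits V lam 0 M).
  apply: nondecreasing_cvg_mu; first by move=> M; exact: measurable_hits.
    by apply: bigcup_measurable => M _; exact: measurable_hits.
  move=> M1 M2 M12; apply/subsetPset => t [j jM Vj]; exists j => //.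
  exact: leq_trans M12.
by apply: (cvge_to_le cV); exact: nearW.
Qed.

(** An unbounded path lies in every [G k], and Ville's inequality bounds the probability of [G k] by
    [V h0 / (k + 1)]. *)
Lemma ae_supermartingale_bounded (V : seq S -> R) : supermartingale V ->
  (forall hs, good hs -> 0 <= V hs) ->
  {ae P, forall t, exists K : R, forall n, V (H n t) < K}.
Proof.
move=> sV V0; pose G k := \bigcup_M hits V k.+1%:R 0 M.
have mG k : measurable (G k).
  by apply: bigcup_measurable => M _; exact: measurable_hits.
exists (\bigcap_k G k); split.
- exact: bigcapT_measurable.
- apply/eqP; rewrite -measure_le0; apply/lee_addgt0Pr => e e0.
  rewrite add0e; have [k hk] : exists k : nat, V h0 / k.+1%:R <= e.
    exists (Num.truncn (V h0 / e)); rewrite ler_pdivrMr// mulrC -ler_pdivrMr//.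
    exact/ltW/truncnS_gt.
  have k0 : (0 : R) < k.+1%:R by [].
  apply: le_trans (le_trans (ville k0 sV V0) _); last by rewrite lee_fin.
  apply: le_measure; rewrite ?inE//; first exact: bigcapT_measurable.
    exact: mG.
  exact: bigcap_inf.
- move=> t /= nK k _.
  have /existsNP[M /negP] : ~ (forall n, V (H n t) < k.+1%:R).
    by move=> h; apply: nK; exists k.+1%:R.
  rewrite -leNgt => ?; exists M => //; exists M => //.
Qed.

(** The indicator of bad histories is a supermartingale, because good histories have only good
    successors, and it starts at 0. Ville's inequality at level 1 gives probability 0. *)
Lemma ae_good_history : {ae P, forall t, forall n, good (H n t)}.
Proof.
pose V hs : R := (~~ good hs)%:R.
have sV : supermartingale V.
  move=> hs ghs; rewrite big1 ?ler0n// => c _.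
  by rewrite /V good_nxt// mulr0.
exists (\bigcup_M hits V 1 0 M); split.
- by apply: bigcup_measurable => M _; exact: measurable_hits.
- apply/eqP; rewrite -measure_le0.
  by apply: le_trans (ville ltr01 sV _) _; rewrite /V ?good_h0 ?mul0r.
- move=> t /= /existsNP[M /negP bM]; exists M => //; exists M => //.
  by rewrite /V add0n bM.
Qed.

(** * Doob's upcrossing argument *)

Section Upcrossings.
Variables (V : seq S -> R) (a b : R).
Hypotheses (sV : supermartingale V) (V0 : forall hs, good hs -> 0 <= V hs).
Hypothesis a0 : 0 <= a.

Fixpoint upcross_state (hs : seq S) : bool * nat :=
  if hs is s :: hs' then upcross_step a b (V hs) (upcross_state hs')
  else (false, 0%N).

(* Wealth of a gambler who holds one unit of [V] exactly during upcrossings. *)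
Definition upcross_wealth (hs : seq S) : R :=
  let: (hi, k) := upcross_state hs in k%:R * (b - a) + (if hi then V hs else a).

(** While the flag is up the wealth follows [V], and closing at a value at least [b] books only [b].
    While it is down the wealth is constant, and opening at a value at most [a] replaces [a] by that
    value. Changes of the flag thus never increase the wealth. *)
Lemma upcross_wealth_supermartingale : a < b -> supermartingale upcross_wealth.
Proof.
move=> ab hs ghs; rewrite /upcross_wealth /=.
case: (upcross_state hs) => -[] k; rewrite /upcross_step /=.
- apply: (@le_trans _ _ (\sum_c pr hs c * (k%:R * (b - a) + V (nxt hs c :: hs)))).
    apply: ler_sum => c _; rewrite ler_wpM2l ?pr_ge0//.
    case: (leP b (V _)) => bV //=.
    by rewrite -natr1; nra.
  under eq_bigr do rewrite mulrDr.
  by rewrite big_split/= -mulr_suml pr_sum// mul1r lerD2l sV.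
- apply: (@le_trans _ _ (\sum_c pr hs c * (k%:R * (b - a) + a))).
    apply: ler_sum => c _; rewrite ler_wpM2l ?pr_ge0//.
    by case: (leP (V _) a) => aV //=; rewrite lerD2l.
  by rewrite -mulr_suml pr_sum// mul1r.
Qed.

(** Each completed upcrossing adds [b - a] to the wealth, so infinitely many would make this
    nonnegative supermartingale unbounded. *)
Lemma ae_finite_upcrossings : a < b ->
  {ae P, forall t, ~ ((forall n, exists2 m, (n < m)%N & V (H m t) <= a) /\
                      (forall n, exists2 m, (n < m)%N & b <= V (H m t)))}.
Proof.
move=> ab.
have W0 hs : good hs -> 0 <= upcross_wealth hs.
  move=> ghs; rewrite /upcross_wealth; case: (upcross_state hs) => -[] k.
    by rewrite addr_ge0 ?V0// mulr_ge0// subr_ge0 ltW.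
  by rewrite addr_ge0// mulr_ge0// subr_ge0 ltW.
have := ae_supermartingale_bounded (upcross_wealth_supermartingale ab) W0.
apply: filterS => t [K HK] [Ha Hb].
have pS n : upcross_state (H n.+1 t) =
    upcross_step a b (V (H n.+1 t)) (upcross_state (H n t)).
  by have [s ->] := H_cons n t.
have [n [pn Kn]] := upcrossings_unbounded pS Ha Hb (Num.truncn (K / (b - a))).+1.
have := HK n; rewrite /upcross_wealth pn; apply/negP; rewrite -leNgt.
have ba : 0 < b - a by rewrite subr_gt0.
rewrite -[leLHS]addr0 lerD// -ler_pdivrMr//.
by apply/ltW/(lt_le_trans (truncnS_gt _)); rewrite ler_nat.
Qed.

End Upcrossings.

(** Doob's convergence theorem: almost surely the path is bounded and crosses none of the countably
    many positive rational intervals, enumerated through [unpickle], infinitely often. *)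
Lemma ae_supermartingale_cvg (V : seq S -> R) : supermartingale V ->
  (forall hs, good hs -> 0 <= V hs) ->
  {ae P, forall t, exists l : R, V (H n t) @[n --> \oo] --> l}.
Proof.
move=> sV V0.
pose cross t (q1 q2 : rat) :=
  (forall n, exists2 m, (n < m)%N & V (H m t) <= ratr q1) /\
  (forall n, exists2 m, (n < m)%N & ratr q2 <= V (H m t)).
have : {ae P, forall t, forall k,
    if @unpickle (rat * rat)%type k is Some (q1, q2) then
    0 < q1 -> q1 < q2 -> ~ cross t q1 q2 else True}.
  apply: ae_foralln => k; case: unpickle => [[q1 q2]|]; last exact: nearW.
  have [q10|q10] := boolP (0 < q1); last by apply: nearW.
  have [q12|q12] := boolP (q1 < q2); last by apply: nearW.
  have q10' : 0 <= ratr q1 :> R by rewrite ler0q ltW.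
  have q12' : ratr q1 < ratr q2 :> R by rewrite ltr_rat.
  have := ae_finite_upcrossings sV V0 q10' q12'.
  by apply: filterS => t ct _ _.
move: (ae_supermartingale_bounded sV V0) ae_good_history.
apply: filterS3 => t [K VK] gt ct.
apply: (@cvg_of_no_crossing _ _ K) => [n|q1 q2 q10 q12].
  by rewrite V0//= ltW.
by have := ct (pickle (q1, q2)); rewrite pickleK; apply.
Qed.

End HistoryProcess.

(** * Maximisers of the product of the edge weights *)

(** The bound [ln (1 + u) <= u] at [u = - xi / (b + xi)] gives a gain of at least [xi / (b + xi)].
    This differs from [xi / b] by [xi ^ 2 / (b (b + xi))], which is at most [M] times a difference
    of reciprocals; that error telescopes along a path. *)
Lemma ln_add_ge (R : realType) (b xi M : R) : 0 < b -> 0 <= xi <= M ->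
  xi / b - M * (b^-1 - (b + xi)^-1) <= ln (b + xi) - ln b.
Proof.
move=> b0 /andP[xi0 xiM]; have bx0 : 0 < b + xi by rewrite ltr_pwDl.
have h : ln (b / (b + xi)) <= b / (b + xi) - 1.
  have -> : b / (b + xi) = 1 + (b / (b + xi) - 1) by ring.
  apply: le_trans (le_ln1Dx _) _; last by rewrite addrAC subrr add0r.
  by rewrite ltrBrDl subrr divr_gt0.
rewrite ln_div ?posrE// in h.
have -> : xi / b - M * (b^-1 - (b + xi)^-1)
    = xi / (b + xi) - (M - xi) * xi / (b * (b + xi)).
  by field; rewrite !gt_eqF.
have -> : ln (b + xi) - ln b = - (ln b - ln (b + xi)) by ring.
have -> : xi / (b + xi) = - (b / (b + xi) - 1) by field; rewrite gt_eqF.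
have : 0 <= (M - xi) * xi / (b * (b + xi)).
  by rewrite !mulr_ge0 ?subr_ge0// invr_ge0 mulr_ge0// ltW.
lra.
Qed.

(** With [p] and [q] the square roots of [w] and [x], this is [ln (q / p) <= q / p - 1] multiplied
    by [2 p ^ 2]. Summed over two probability vectors, it bounds the squared Hellinger distance by
    the relative entropy. The case [w = 0] serves limit points on the boundary. *)
Lemma sqr_dist_le_entropy_term (R : realType) (w x : R) : 0 <= w -> 0 < x ->
  (Num.sqrt w - Num.sqrt x) ^+ 2 <= w * ln w - w * ln x - w + x.
Proof.
move=> w0 x0; have [->|wn0] := eqVneq w 0.
  by rewrite !mul0r !subr0 add0r sqrtr0 sub0r sqrrN sqr_sqrtr ?lexx ?ltW.
have {}w0 : 0 < w by rewrite lt_neqAle eq_sym wn0.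
have p0 : 0 < Num.sqrt w by rewrite sqrtr_gt0.
have q0 : 0 < Num.sqrt x by rewrite sqrtr_gt0.
have Ew : w = Num.sqrt w ^+ 2 by rewrite sqr_sqrtr ?ltW.
have Ex : x = Num.sqrt x ^+ 2 by rewrite sqr_sqrtr ?ltW.
move: (Num.sqrt w) (Num.sqrt x) p0 q0 Ew Ex => p q p0 q0 -> ->.
rewrite !lnXn//.
have h : ln (q / p) <= q / p - 1.
  have -> : q / p = 1 + (q / p - 1) by ring.
  apply: le_trans (le_ln1Dx _) _; last by rewrite addrAC subrr add0r.
  by rewrite ltrBrDl subrr divr_gt0.
rewrite ln_div ?posrE// in h.
have : p ^+ 2 * (ln q - ln p) <= p ^+ 2 * (q / p - 1).
  by rewrite ler_pM2l// exprn_gt0.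
have -> : p ^+ 2 * (q / p - 1) = q * p - p ^+ 2 by field; rewrite gt_eqF.
rewrite !mulr2n; nra.
Qed.

Lemma cvg_rV_coord (R : realType) (m : nat) (u : nat -> 'rV[R]_m) (y : 'rV[R]_m) :
  (forall i, u n ord0 i @[n --> \oo] --> y ord0 i) -> u @ \oo --> y.
Proof.
move=> uy; apply/cvg_ballP => eps eps0.
have : \forall n \near \oo, forall i, ball (y ord0 i) eps (u n ord0 i).
  by apply: filter_forall => i; move/cvg_ballP: (uy i); exact.
apply: filterS => n h; split=> // i j.
by rewrite ord1; exact: h.
Qed.

(** * Edge weights on the simplex *)

Section Hypergraph.
Variables (R : realType) (m N : nat) (e : 'I_N -> {set 'I_m}).
Hypothesis He : hypergraph_ok e.

Implicit Types (x w : 'rV[R]_m) (k : 'I_N).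

(** A Pinsker-type bound: [(q ^ 2 - p ^ 2) ^ 2 = (p + q) ^ 2 (p - q) ^ 2], and [p + q <= 2] because
    the coordinates are at most 1. *)
Lemma sqr_dist_le_entropy w x i : simplex w -> simplex x ->
  (forall i, 0 < x ord0 i) ->
  (x ord0 i - w ord0 i) ^+ 2 <=
  4 * (\sum_j w ord0 j * ln (w ord0 j) - \sum_j w ord0 j * ln (x ord0 j)).
Proof.
move=> [w0 w1] [x0 x1] xp.
have le1 (y : 'rV[R]_m) : simplex y -> y ord0 i <= 1.
  by move=> [y0 <-]; rewrite (bigD1 i)//= lerDl sumr_ge0.
apply: (@le_trans _ _ (4 * (Num.sqrt (w ord0 i) - Num.sqrt (x ord0 i)) ^+ 2)).
  move: (w0 i) (x0 i) (le1 w (conj w0 w1)) (le1 x (conj x0 x1)).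
  move: (w ord0 i) (x ord0 i) => a b a0 b0.
  move: (sqrtr_ge0 a) (sqrtr_ge0 b) (esym (sqr_sqrtr a0)) (esym (sqr_sqrtr b0)).
  move: (Num.sqrt a) (Num.sqrt b) => p q p0 q0 -> -> p1 q1.
  have {}p1 : p <= 1 by nra.
  have {}q1 : q <= 1 by nra.
  have -> : (q ^+ 2 - p ^+ 2) ^+ 2 = (p + q) ^+ 2 * (p - q) ^+ 2 by ring.
  by rewrite ler_wpM2r ?sqr_ge0//; nra.
rewrite ler_pM2l//.
apply: (@le_trans _ _ (\sum_j (Num.sqrt (w ord0 j) - Num.sqrt (x ord0 j)) ^+ 2)).
  by rewrite (bigD1 i)//= lerDl sumr_ge0// => j _; rewrite sqr_ge0.
apply: (@le_trans _ _ (\sum_j (w ord0 j * ln (w ord0 j) - w ord0 j * ln (x ord0 j)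
   - w ord0 j + x ord0 j))).
  by apply: ler_sum => j _; exact: sqr_dist_le_entropy_term.
by rewrite !big_split/= !sumrN w1 x1 addrNK.
Qed.

Definition edge_weight (x : 'I_m -> R) k := \sum_(j in e k) x j.

Definition weight_product x := \prod_k edge_weight (x ord0) k.

(** For a maximiser [w0] this is the set J of the theorem. Linear equations on the simplex make
    closedness, convexity and the affine hull direct to handle. *)
Definition same_edge_weights (w0 : 'rV[R]_m) : set 'rV[R]_m :=
  [set x | simplex x /\
           forall k, edge_weight (x ord0) k = edge_weight (w0 ord0) k].

Lemma edge_weight_ge0 x k : (forall i, 0 <= x ord0 i) ->
  0 <= edge_weight (x ord0) k.
Proof. by move=> x0; rewrite sumr_ge0. Qed.

Lemma edge_weight_gt0 (b : 'I_m -> R) k : (forall i, 0 < b i) ->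
  0 < edge_weight b k.
Proof.
have [_ _ e0 _] := He => b0.
have [i ik] := set0Pn _ (e0 k).
rewrite /edge_weight (bigD1 i)//= ltr_pwDl// sumr_ge0// => j _.
exact: ltW.
Qed.

Lemma continuous_edge_weight k :
  continuous (fun x : 'rV[R]_m => edge_weight (x ord0) k).
Proof.
apply: continuous_big; first exact: add_continuous.
by move=> i _; exact: coord_continuous.
Qed.

Lemma continuous_weight_product : continuous weight_product.
Proof.
apply: continuous_big; first exact: mul_continuous.
by move=> k _; exact: continuous_edge_weight.
Qed.

Lemma closed_simplex : closed (@simplex R m).
Proof.
rewrite (_ : @simplex R m = (\bigcap_i ((fun x : 'rV[R]_m => x ord0 i) @^-1`
    [set y | 0 <= y])) `&` (fun x : 'rV[R]_m => \sum_i x ord0 i) @^-1` [set 1]).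
  apply: closedI; first apply: closed_bigI => i _.
    by apply: preimage_closed => [x _|]; [exact: coord_continuous|exact: closed_ge].
  apply: preimage_closed => [x _|]; last exact: closed_eq.
  apply: continuous_big; first exact: add_continuous.
  by move=> i _; exact: coord_continuous.
apply/seteqP; split=> x; first by move=> [x0 x1]; split=> // i _; exact: x0.
by move=> [x0 x1]; split=> // i; exact: x0.
Qed.

Lemma compact_simplex : compact (@simplex R m).
Proof.
apply: (subclosed_compact closed_simplex
  (@rV_compact R m (fun=> `[0, 1]%classic) (fun=> @segment_compact R 0 1))).
move=> x [x0 x1] i /=; rewrite in_itv/= x0/= -x1 (bigD1 i)//= lerDl.
exact: sumr_ge0.
Qed.

(** The maximum exists by compactness, and it is positive because the uniform vector [u] gives every
    nonempty hyperedge a positive weight. *)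
Lemma weight_product_max : exists w0, [/\ simplex w0, 0 < weight_product w0 &
  forall x, simplex x -> weight_product x <= weight_product w0].
Proof.
have [N0 _ e0 _] := He.
have [i0 _] := set0Pn _ (e0 (Ordinal N0)).
have m0 : (0 < m)%N by rewrite (leq_trans _ (ltn_ord i0)).
pose u : 'rV[R]_m := const_mx m%:R^-1.
have su : simplex u.
  split=> [i|]; first by rewrite mxE invr_ge0.
  under eq_bigr do rewrite mxE.
  by rewrite sumr_const card_ord -[LHS]mulr_natl divff// pnatr_eq0 -lt0n.
have [w0 sw0 max0] := compact_EVT_max (ex_intro _ u su) compact_simplex
  (continuous_subspaceT continuous_weight_product).
rewrite inE in sw0; exists w0; split=> // [|x sx]; last first.
  by apply: max0; rewrite inE.
apply: (@lt_le_trans _ _ (weight_product u)); last by apply: max0; rewrite inE.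
apply: prodr_gt0 => k _; apply: edge_weight_gt0 => i.
by rewrite mxE invr_gt0 ltr0n.
Qed.


Lemma closed_same_edge_weights w0 : closed (same_edge_weights w0).
Proof.
rewrite (_ : same_edge_weights w0 = @simplex R m `&`
  \bigcap_k ((fun x : 'rV[R]_m => edge_weight (x ord0) k) @^-1`
             [set edge_weight (w0 ord0) k])).
  apply: closedI; first exact: closed_simplex.
  apply: closed_bigI => k _; apply: preimage_closed => [x _|].
    exact: continuous_edge_weight.
  exact: closed_eq.
apply/seteqP; split=> x [sx wx]; split=> // k; last exact: wx.
by move=> _; exact: wx.
Qed.

Lemma edge_weight_affine (t : R) x y k :
  edge_weight ((t *: x + (1 - t) *: y) ord0) k =
  t * edge_weight (x ord0) k + (1 - t) * edge_weight (y ord0) k.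
Proof.
rewrite /edge_weight !mulr_sumr -big_split/=.
by apply: eq_bigr => i _; rewrite !mxE.
Qed.

Lemma simplex_convex (t : R) x y : 0 <= t <= 1 -> simplex x -> simplex y ->
  simplex (t *: x + (1 - t) *: y).
Proof.
move=> /andP[t0 t1] [x0 x1] [y0 y1]; split=> [i|].
  by rewrite !mxE addr_ge0// mulr_ge0// subr_ge0.
under eq_bigr do rewrite !mxE.
by rewrite big_split/= -!mulr_sumr x1 y1 !mulr1 addrC subrK.
Qed.

(** The set is the union of the segments joining [w0] to its points. *)
Lemma connected_same_edge_weights w0 : simplex w0 ->
  connected (same_edge_weights w0).
Proof.
move=> sw0.
pose seg (y : 'rV[R]_m) := [set t *: y + (1 - t) *: w0 | t in `[0, 1]%classic].
rewrite (_ : same_edge_weights w0 = \bigcup_(y in same_edge_weights w0) seg y).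
  apply: bigcup_connected.
    exists w0 => y _; exists 0; first by rewrite /= in_itv/= lexx ler01.
    by rewrite scale0r add0r subr0 scale1r.
  move=> y _; apply: connected_continuous_connected.
    exact: segment_connected.
  apply: continuous_subspaceT => t.
  apply: cvgD; first by apply: cvgZr_tmp; exact: cvg_id.
  by apply: cvgZr_tmp; apply: cvgB; [exact: cvg_cst|exact: cvg_id].
apply/seteqP; split=> [y Jy|x [y [sy wy] [t]]].
  exists y => //; exists 1; first by rewrite /= in_itv/= lexx ler01.
  by rewrite scale1r subrr scale0r addr0.
rewrite /= in_itv/= => t01 <-; split; first exact: simplex_convex.
by move=> k; rewrite edge_weight_affine wy -mulrDl addrC subrK mul1r.
Qed.

Lemma affine_same_edge_weights w0 :
  affine_subspace [set x : 'rV[R]_m |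
    forall k, edge_weight (x ord0) k = edge_weight (w0 ord0) k].
Proof.
split; first by exists w0.
by move=> x y t xw yw k; rewrite edge_weight_affine xw yw -mulrDl addrC subrK mul1r.
Qed.

(** * Maximisers, the AM-GM gap and the drift *)

Section Maximiser.
Variable w0 : 'rV[R]_m.
Hypothesis w0_simplex : simplex w0.
Hypothesis w0_gt0 : 0 < weight_product w0.
Hypothesis w0_max : forall x, simplex x -> weight_product x <= weight_product w0.

Lemma edge_weights_gt0 x : simplex x -> 0 < weight_product x ->
  forall k, 0 < edge_weight (x ord0) k.
Proof.
move=> [x0 _] xp k; rewrite lt_neqAle edge_weight_ge0// andbT eq_sym.
by apply: contraTneq xp => xk; rewrite /weight_product (bigD1 k)//= xk mul0r ltxx.
Qed.

(* Strict AM-GM at the midpoint: edge weights of maximisers are unique. *)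
Lemma maximiser_same_edge_weights x : simplex x ->
  weight_product w0 <= weight_product x -> same_edge_weights w0 x.
Proof.
move=> sx w0x; split=> // k; apply/eqP; apply: contraT => xk.
have xp : 0 < weight_product x by exact: lt_le_trans w0x.
have xk0 := edge_weights_gt0 sx xp; have wk0 := edge_weights_gt0 w0_simplex w0_gt0.
pose y := 2^-1 *: x + (1 - 2^-1) *: w0.
have half : 0 <= (2^-1 : R) <= 1 by rewrite invr_ge0 ler0n /= invf_le1 ?ler1n.
have yk j : edge_weight (y ord0) j =
    (edge_weight (x ord0) j + edge_weight (w0 ord0) j) / 2.
  by rewrite edge_weight_affine; field.
have ge j : edge_weight (x ord0) j * edge_weight (w0 ord0) j <=
    edge_weight (y ord0) j ^+ 2.
  by rewrite yk; exact: (leif_AGM2 _ _).1.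
have gt : edge_weight (x ord0) k * edge_weight (w0 ord0) k <
    edge_weight (y ord0) k ^+ 2.
  by rewrite lt_neqAle ge andbT yk (leif_AGM2 _ _).2.
have yw : weight_product y ^+ 2 <= weight_product x * weight_product w0.
  apply: (@le_trans _ _ (weight_product w0 ^+ 2)).
    rewrite lerXn2r ?nnegrE ?w0_max//; [|exact: ltW|exact: simplex_convex].
    apply: prodr_ge0 => j _; apply: edge_weight_ge0.
    by have [] := simplex_convex half sx w0_simplex.
  by rewrite expr2 ler_pM2r.
move: yw; rewrite leNgt => /negP; case.
rewrite -prodrXl -big_split/= (bigD1 k)//= [ltRHS](bigD1 k)//=.
have pp : 0 < \prod_(j | j != k) (edge_weight (x ord0) j * edge_weight (w0 ord0) j).
  by apply: prodr_gt0 => j _; rewrite mulr_gt0.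
apply: (@lt_le_trans _ _ (edge_weight (y ord0) k ^+ 2 *
   \prod_(j | j != k) (edge_weight (x ord0) j * edge_weight (w0 ord0) j))).
  by rewrite ltr_pM2r.
rewrite ler_pM2l; last by apply: le_lt_trans gt; rewrite mulr_ge0// ltW.
by apply: ler_prod => j _; rewrite ge mulr_ge0// ltW.
Qed.

(** AM-GM applied to the ratios of the edge weights of [w0] to those of [x]. *)
Lemma weight_product_le_mean x : (forall k, 0 < edge_weight (x ord0) k) ->
  weight_product w0 <=
  ((\sum_k edge_weight (w0 ord0) k / edge_weight (x ord0) k) / N%:R) ^+ N *
  weight_product x.
Proof.
move=> xk; have wk := edge_weights_gt0 w0_simplex w0_gt0.
have xp : 0 < weight_product x by exact: prodr_gt0.
rewrite -ler_pdivrMr// /weight_product -prodf_div.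
have := (@leif_AGM R 'I_N predT
  (fun k => edge_weight (w0 ord0) k / edge_weight (x ord0) k) _).1.
rewrite card_ord; apply => k _.
by rewrite divr_ge0// ltW.
Qed.

(** Maximality of [w0] and the AM-GM bound force the [N]-th power of the mean ratio to be at least
    1. *)
Lemma mean_edge_ratio_ge1 x : simplex x -> (forall k, 0 < edge_weight (x ord0) k) ->
  N%:R <= \sum_k edge_weight (w0 ord0) k / edge_weight (x ord0) k.
Proof.
move=> sx xk; have wk := edge_weights_gt0 w0_simplex w0_gt0.
have [N0 _ _ _] := He; have N0' : 0 < N%:R :> R by rewrite ltr0n.
have xp : 0 < weight_product x by exact: prodr_gt0.
rewrite -[leLHS]mul1r -ler_pdivlMr// -(@expr_ge1 _ N)//; last first.
  by rewrite divr_ge0// sumr_ge0// => k _; rewrite divr_ge0// ltW.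
rewrite -(ler_pM2r xp) mul1r (le_trans (w0_max sx))//.
exact: weight_product_le_mean.
Qed.


(** The first sum is the conditional expectation of the first-order gain of [sum_i w0_i ln b_i] in
    one step; the subtracted term bounds the growth of the logarithm of the total. *)
Definition drift (b : 'I_m -> R) :=
  \sum_k edge_weight (w0 ord0) k / edge_weight b k - N%:R / \sum_i b i.

Definition proportions (b : 'I_m -> R) : 'rV[R]_m := \row_i (b i / \sum_j b j).

Definition entropy_part w (b : 'I_m -> R) :=
  \sum_i w ord0 i * ln (proportions b ord0 i).

Lemma sum_gt0 (b : 'I_m -> R) : (forall i, 0 < b i) -> 0 < \sum_i b i.
Proof.
have [N0 _ e0 _] := He => b0.
have [i0 _] := set0Pn _ (e0 (Ordinal N0)).
by rewrite (bigD1 i0)//= ltr_pwDl// sumr_ge0// => j _; exact: ltW.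
Qed.

Lemma proportions_gt0 (b : 'I_m -> R) i : (forall i, 0 < b i) ->
  0 < proportions b ord0 i.
Proof. by move=> b0; rewrite mxE divr_gt0// sum_gt0. Qed.

Lemma proportions_simplex (b : 'I_m -> R) : (forall i, 0 < b i) ->
  simplex (proportions b).
Proof.
move=> b0; split=> [i|]; first exact/ltW/proportions_gt0.
under eq_bigr do rewrite mxE.
by rewrite -mulr_suml divff// gt_eqF// sum_gt0.
Qed.

Lemma drift_proportions (b : 'I_m -> R) : (forall i, 0 < b i) ->
  \sum_k edge_weight (w0 ord0) k / edge_weight (proportions b ord0) k =
  N%:R + (\sum_i b i) * drift b.
Proof.
move=> b0; have T0 := sum_gt0 b0; rewrite /drift mulrBr.
rewrite [X in _ - X]mulrC divfK ?gt_eqF// addrC subrK mulr_sumr.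
apply: eq_bigr => k _.
have -> : edge_weight (proportions b ord0) k = edge_weight b k / \sum_i b i.
  by rewrite /edge_weight mulr_suml; apply: eq_bigr => i _; rewrite mxE.
by rewrite invf_div mulrCA.
Qed.

Lemma drift_ge0 (b : 'I_m -> R) : (forall i, 0 < b i) -> 0 <= drift b.
Proof.
move=> b0; have T0 := sum_gt0 b0.
rewrite -(pmulr_rge0 _ T0) -(lerD2l N%:R) addr0 -drift_proportions//.
apply: mean_edge_ratio_ge1; first exact: proportions_simplex.
by move=> k; apply: edge_weight_gt0 => i; exact: proportions_gt0.
Qed.

Lemma entropy_part_le0 w (b : 'I_m -> R) : (forall i, 0 <= w ord0 i) ->
  (forall i, 0 < b i) -> entropy_part w b <= 0.
Proof.
move=> w1 b0; rewrite -oppr_ge0 -sumrN sumr_ge0// => i _.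
rewrite -mulrN mulr_ge0// oppr_ge0 ln_le0//.
have [x0 <-] := proportions_simplex b0.
by rewrite (bigD1 i)//= lerDl sumr_ge0.
Qed.

(** * Convergence of a single path *)

Section UrnPath.
Variables (b : nat -> 'I_m -> R) (c : R) (s : seq 'rV[R]_m).
Hypothesis c_gt0 : 0 < c.
Hypothesis b_gt0 : forall n i, 0 < b n i.
Hypothesis b_sum : forall n, \sum_i b n i = c + n%:R * N%:R.
Hypothesis b_le : forall n i, b n i <= b n.+1 i.
Hypothesis s_w0 : w0 \in s.
Hypothesis s_span : forall w, same_edge_weights w0 w -> w \in span s.

Let x n := proportions (b n).
Let A n := \sum_(k < n) drift (b k).

Hypothesis s_cvg : forall w, w \in s ->
  exists l : R, N%:R * (\sum_i w ord0 i / b n i) - entropy_part w (b n) + A n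
    @[n --> \oo] --> l.

(** The partial sums increase, and they are bounded by the convergent expression for [w0], whose
    other two contributions are nonnegative. *)
Lemma cvg_drift_sum : exists l : R, A @ \oo --> l.
Proof.
have [l Vl] := s_cvg s_w0.
have [M [_ HM]] := cvg_seq_bounded (cvgP _ Vl).
have [w1 _] := w0_simplex.
exists (limn A); apply: nondecreasing_is_cvgn.
  apply/nondecreasing_seqP => n; rewrite /A big_ord_recr/= lerDl.
  exact: drift_ge0.
exists (M + 1) => _ [n _ <-].
have ltM : M < M + 1 by rewrite ltrDl.
have := HM _ ltM n I; rewrite /= ler_norml => /andP[_].
apply: le_trans; rewrite lerDr subr_ge0 (le_trans (entropy_part_le0 w1 (b_gt0 n)))//.
by rewrite mulr_ge0// sumr_ge0// => i _; rewrite mulr_ge0// invr_ge0 ltW.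
Qed.

Lemma cvg_inv_count i : cvgn (fun n => (b n i)^-1).
Proof.
apply: nonincreasing_is_cvgn.
  by apply/nonincreasing_seqP => n; rewrite lef_pV2 ?posrE.
by exists 0 => _ [n _ <-]; rewrite invr_ge0 ltW.
Qed.

(** For [v] in [s], the drift sum and the reciprocals of the nondecreasing counts converge and can
    be subtracted. Linearity in [w] extends this to the span. *)
Lemma cvg_entropy_part w : same_edge_weights w0 w ->
  exists l : R, entropy_part w (b n) @[n --> \oo] --> l.
Proof.
move=> /s_span/(@coord_span _ _ _ (in_tuple s)) ->.
suff : cvgn (fun n => entropy_part (\sum_(i < size s)
    coord (in_tuple s) i w *: (in_tuple s)`_i) (b n)).
  by move=> /cvg_ex.
elim/big_ind : _ => [|u v cu cv|i _].
- have -> : (fun n => entropy_part 0 (b n)) = fun=> 0.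
    by apply/funext => n; rewrite /entropy_part big1// => i _; rewrite mxE mul0r.
  exact: is_cvg_cst.
- have -> : (fun n => entropy_part (u + v) (b n)) =
      (fun n => entropy_part u (b n)) \+ (fun n => entropy_part v (b n)).
    apply/funext => n; rewrite /entropy_part /= -big_split/=.
    by apply: eq_bigr => i _; rewrite [in LHS]mxE mulrDl.
  exact: is_cvgD.
set a := coord _ _ _; set v := _`_i.
have -> : (fun n => entropy_part (a *: v) (b n)) =
    fun n => a * entropy_part v (b n).
  apply/funext => n; rewrite /entropy_part mulr_sumr.
  by apply: eq_bigr => j _; rewrite [in LHS]mxE mulrA.
apply: is_cvgMr.
have vs : v \in s by exact: mem_nth.
have [l Vl] := s_cvg vs; have [l' Al'] := cvg_drift_sum.
have -> : (fun n => entropy_part v (b n)) = (fun n =>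
   N%:R * (\sum_i v ord0 i / b n i) - (N%:R * (\sum_i v ord0 i / b n i) -
      entropy_part v (b n) + A n) + A n).
  by apply/funext => n; ring.
apply: is_cvgD; last exact: cvgP Al'.
apply: is_cvgB; last exact: cvgP Vl.
apply: is_cvgMr.
apply/cvg_ex; exists (\sum_i v ord0 i * limn (fun n => (b n i)^-1)).
apply: cvg_big; first exact: add_continuous.
by move=> j _; apply: cvgMr; exact: cvg_inv_count.
Qed.



(* [drift] is of order [1 / n] times the AM-GM gap, and the harmonic series
   diverges. *)
Lemma small_drift (eps : R) (n0 : nat) : 0 < eps ->
  exists2 n, (n0 <= n)%N & (\sum_i b n i) * drift (b n) < eps.
Proof.
move=> eps0; apply: contrapT => big.
have {}big n : (n0 <= n)%N -> eps <= (\sum_i b n i) * drift (b n).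
  by move=> n0n; rewrite leNgt; apply/negP => h; apply: big; exists n.
have [l Al] := cvg_drift_sum.
have cN : 0 < c + 2 * N%:R by rewrite ltr_pwDl// mulr_ge0.
(* For times [k] from [n] to [2 n] the total [c + k N] is at most [(c + 2 N) n], so each drift is at
   least [eta / n]. The [n] terms add up to [eta], whereas [A n] and [A (2 n)] both lie within
   [eta / 2] of the limit. *)
pose eta := eps / (c + 2 * N%:R).
have eta0 : 0 < eta / 2 by rewrite !divr_gt0.
have [n1 _ Hn1] : \forall n \near \oo, `|l - A n| < eta / 2.
  by move/cvgrPdist_lt: Al; exact.
pose n := (maxn n0 n1).+1.
have n0n : (n0 <= n)%N by rewrite leqW// leq_maxl.
have n1n : (n1 <= n)%N by rewrite leqW// leq_maxr.
have step j : (j <= n)%N -> A n + j%:R * (eta / n%:R) <= A (n + j)%N.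
  elim: j => [|j IH] jn; first by rewrite mul0r addr0 addn0.
  rewrite -natr1 mulrDl mul1r addrA addnS [leRHS]big_ord_recr/=.
  apply: lerD; first by apply: IH; exact: ltnW.
  have nj : (n0 <= n + j)%N by rewrite (leq_trans n0n)// leq_addr.
  have T0 := sum_gt0 (b_gt0 (n + j)).
  apply: (@le_trans _ _ (eps / \sum_i b (n + j)%N i)); last first.
    by rewrite ler_pdivrMr// mulrC big.
  rewrite /eta -mulrA -invfM ler_pM2l// lef_pV2 ?posrE//; last first.
    by rewrite mulr_gt0// ltr0n.
  rewrite b_sum natrD.
  have n1' : 1 <= n%:R :> R by rewrite ler1n.
  have jn' : j%:R <= n%:R :> R by rewrite ler_nat ltnW.
  have h1 : 0 <= c * (n%:R - 1) by rewrite mulr_ge0 ?subr_ge0// ltW.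
  have h2 : 0 <= N%:R * (n%:R - j%:R) :> R by rewrite mulr_ge0 ?subr_ge0.
  move: n%:R j%:R N%:R h1 h2 => p q r; rewrite !(mulrBr, mulr1) => h1 h2.
  nra.
have := step n (leqnn n).
rewrite mulrCA divff ?pnatr_eq0// mulr1.
have := Hn1 n n1n; have := Hn1 (n + n)%N (leq_trans n1n (leq_addr _ _)).
rewrite /= !ltr_norml => /andP[h1 h2] /andP[h3 h4].
lra.
Qed.

(** Times of small drift are chosen first, and compactness gives a cluster point [y] of the path
    along them. Choosing again among these times, close to [y], keeps the drift small. *)
Lemma urn_subsequence : exists y (phi : nat -> nat),
  [/\ forall j, (j <= phi j)%N, x (phi j) @[j --> \oo] --> y, simplex y &
      forall j, (\sum_i b (phi j) i) * drift (b (phi j)) < j.+1%:R^-1].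
Proof.
have dr j : {n | (j <= n)%N & (\sum_i b n i) * drift (b n) < j.+1%:R^-1}.
  by apply/cid2; apply: small_drift.
pose u j := x (s2val (dr j)).
have [y [sy cy]] : exists y, (@simplex R m `&` cluster (u @ \oo)) y.
  apply: compact_simplex; exists 0%N => // j _.
  exact: (proportions_simplex (b_gt0 _)).
have near_y j : {n | (j <= n)%N & ball y j.+1%:R^-1 (x n) /\
    (\sum_i b n i) * drift (b n) < j.+1%:R^-1}.
  apply/cid2.
  have [] := cy [set u k | k in [set k | (j <= k)%N]] (ball y j.+1%:R^-1).
  - by exists j => // k /= jk; exists k.
  - by apply: nbhsx_ballx; rewrite invr_gt0.
  move=> _ [[k /= jk <-] yk]; exists (s2val (dr k)).
    exact: leq_trans (s2valP (dr k)).
  split=> //; apply: lt_le_trans (s2valP' (dr k)) _.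
  by rewrite lef_pV2 ?posrE// ler_nat.
exists y, (fun j => s2val (near_y j)); split=> // [j||j].
- exact: s2valP (near_y j).
- apply/cvg_ballP => eps eps0; near=> j.
  apply: (@le_ball _ _ y j.+1%:R^-1 eps); last by have [] := s2valP' (near_y j).
  apply: ltW; near: j.
  exact: (near_infty_natSinv_lt (PosNum eps0)).
- by have [] := s2valP' (near_y j).
Unshelve. all: by end_near. Qed.

Lemma urn_path_cvg : exists2 y, same_edge_weights w0 y & x @ \oo --> y.
Proof.
have [y [phi [phi_ge xy sy phi_drift]]] := urn_subsequence.
have [N0 _ _ _] := He; have N0' : 0 < N%:R :> R by rewrite ltr0n.
have Jy : same_edge_weights w0 y.
  apply: maximiser_same_edge_weights => //.
  (* Along [phi] the mean ratio is 1 plus the total times the drift, divided by [N], hence at most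
     [1 + harmonic j / N]; the AM-GM bound then passes to the limit. *)
  have lim : (1 + N%:R^-1 * harmonic j) ^+ N * weight_product (x (phi j))
      @[j --> \oo] --> weight_product y.
    have -> : weight_product y = (1 + N%:R^-1 * 0) ^+ N * weight_product y.
      by rewrite mulr0 addr0 expr1n mul1r.
    apply: cvgM; last first.
      by apply: continuous_cvg => //; exact: continuous_weight_product.
    apply: (@continuous_cvg _ _ _ _ _ _ (fun z : R => z ^+ N)).
      exact: exprn_continuous.
    by apply: cvgD; [exact: cvg_cst|apply: cvgMr; exact: cvg_harmonic].
  apply: (cvgr_to_ge lim); apply: nearW => j.
  have xp := edge_weight_gt0 _ (fun i => proportions_gt0 i (b_gt0 (phi j))).
  apply: le_trans (weight_product_le_mean xp) _.
  rewrite ler_wpM2r//.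
    by apply: prodr_ge0 => k _; exact/ltW/xp.
  have T0 := sum_gt0 (b_gt0 (phi j)).
  have d0 : 0 <= drift (b (phi j)) by exact: drift_ge0.
  rewrite drift_proportions// mulrDl divff ?gt_eqF// lerXn2r ?nnegrE//.
  - by rewrite addr_ge0// divr_ge0// mulr_ge0// ltW.
  - by rewrite addr_ge0// mulr_ge0// harmonic_ge0.
  - by rewrite lerD2l mulrC ler_pM2l ?invr_gt0// ltW// phi_drift.
exists y => //.
have [l Yl] := cvg_entropy_part Jy.
have phi_oo : phi @ \oo --> \oo.
  move=> B [n _ nB]; exists n => // j /= nj; apply: nB => /=.
  exact: leq_trans (phi_ge j).
have [y0 _] := sy.
(* The limit along the whole path is identified along [phi]; the relative entropy to [y] therefore
   tends to 0. *)
have lE : l = \sum_i y ord0 i * ln (y ord0 i).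
  have Yphi : entropy_part y (b (phi j)) @[j --> \oo] --> l.
    exact: (cvg_comp _ _ phi_oo Yl).
  apply: (cvg_unique (@norm_hausdorff _ R) Yphi).
  apply: cvg_big; first exact: add_continuous.
  (* A coordinate with [y_i = 0] contributes 0 at every time; at the others [ln] is continuous. *)
  move=> i _; have [->|yi] := eqVneq (y ord0 i) 0.
    by rewrite mul0r; under eq_cvg do rewrite mul0r; exact: cvg_cst.
  apply: cvgMr; apply: continuous_cvg.
    by apply: continuous_ln; rewrite lt_neqAle eq_sym yi y0.
  exact: (cvg_comp (fun j => x (phi j)) (fun z : 'rV[R]_m => z ord0 i) xy
    (@coord_continuous R _ _ ord0 i y)).
pose E := \sum_j y ord0 j * ln (y ord0 j).
apply: cvg_rV_coord => i.
have sq : (x n ord0 i - y ord0 i) ^+ 2 @[n --> \oo] --> (0 : R).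
  apply: (@squeeze_cvgr _ _ _ _ (fun=> 0)
    (fun n => 4 * (E - entropy_part y (b n)))).
  - apply: nearW => n; rewrite sqr_ge0/= sqr_dist_le_entropy//.
      exact: proportions_simplex.
    by move=> j; exact: proportions_gt0.
  - exact: cvg_cst.
  - rewrite -(mulr0 4) -(subrr E) -[X in _ - X]lE.
    by apply: cvgMr; apply: (cvgB _ Yl); exact: cvg_cst.
apply/cvgrPdist_lt => eps eps0.
have eps2 : 0 < eps ^+ 2 by rewrite exprn_gt0.
move/cvgrPdist_lt: sq => /(_ _ eps2); apply: filterS => n.
rewrite sub0r normrN ger0_norm ?sqr_ge0// => h.
rewrite distrC -(@ltr_pXn2r _ 2) ?nnegrE//; last exact: ltW.
by rewrite real_normK// num_real.
Qed.

End UrnPath.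

End Maximiser.

End Hypergraph.

(** * The urn *)

(** A list in [J] whose span has maximal dimension cannot gain from a further element of [J]. This
    reduces almost sure convergence for uncountably many [w] to finitely many. *)
Lemma finite_spanning_subset (K : fieldType) (vT : vectType K) (J : set vT)
    (w0 : vT) : J w0 ->
  exists s : seq vT, [/\ w0 \in s, forall w, w \in s -> J w &
    forall w, J w -> w \in span s].
Proof.
move=> Jw0.
pose Q d := `[< exists s : seq vT, [/\ w0 \in s, forall w, w \in s -> J w &
  \dim (span s) = d] >].
have exQ : exists d, Q d.
  exists (\dim (span [:: w0])); apply/asboolP; exists [:: w0]; split=> //.
    by rewrite inE.
  by move=> w; rewrite inE => /eqP ->.
have bQ d : Q d -> (d <= \dim {:vT})%N.
  by move=> /asboolP[s [_ _ <-]]; exact/dimvS/subvf.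
case: (ex_maxnP exQ bQ) => d /asboolP[s [w0s sJ dims]] maxd.
exists s; split=> // w Jw.
have sub : (span s <= span (w :: s))%VS by apply: sub_span => v; rewrite inE orbC => ->.
have /maxd dle : Q (\dim (span (w :: s))).
  apply/asboolP; exists (w :: s); split=> //; first by rewrite inE w0s orbT.
  by move=> v; rewrite inE => /predU1P[->//|/sJ].
have /eqP -> : (span s == span (w :: s))%VS.
  by rewrite -(dimv_leqif_eq sub) eqn_leq dimvS// dims dle.
by rewrite memv_span// mem_head.
Qed.

(** Expectation of a function of one coordinate under a product law: [phi] is absorbed into the
    factor [k0], and the sum of products becomes a product of sums. *)
Lemma sum_prod_marginal (R : comPzRingType) (I J : finType) (f : I -> J -> R)
    (phi : J -> R) (k0 : I) : (forall k, \sum_j f k j = 1) ->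
  \sum_(c : {ffun I -> J}) (\prod_k f k (c k)) * phi (c k0) =
  \sum_j f k0 j * phi j.
Proof.
move=> f1.
pose g k j := if k == k0 then f k j * phi j else f k j.
transitivity (\sum_(c : {ffun I -> J}) \prod_k g k (c k)).
  apply: eq_bigr => c _; rewrite (bigD1 k0)//= [RHS](bigD1 k0)//= /g eqxx.
  rewrite mulrAC; congr (_ * _); apply: eq_bigr => k /negbTE ->.
  by [].
rewrite -bigA_distr_bigA (bigD1 k0)//= [X in _ * X]big1 ?mulr1.
  by apply: eq_bigr => j _; rewrite /g eqxx.
by move=> k /negbTE kk0; rewrite -[RHS](f1 k); apply: eq_bigr => j _; rewrite /g kk0.
Qed.

(** * One step of the Lyapunov function *)

Section Urn.
Variables (R : realType) (m N : nat) (e : 'I_N -> {set 'I_m}).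
Hypothesis He : hypergraph_ok e.
Variable w0 : 'rV[R]_m.
Hypothesis w0_simplex : simplex w0.
Hypothesis w0_gt0 : 0 < weight_product e w0.
Hypothesis w0_max : forall x, simplex x -> weight_product e x <= weight_product e w0.

Definition lyapunov (w : 'rV[R]_m) (b : 'I_m -> R) :=
  N%:R * (\sum_i w ord0 i / b i) - entropy_part w b.

Lemma entropy_partE (w : 'rV[R]_m) (b : 'I_m -> R) : simplex w ->
  (forall i, 0 < b i) ->
  entropy_part w b = \sum_i w ord0 i * ln (b i) - ln (\sum_i b i).
Proof.
move=> [_ w1] b0; rewrite -[ln (\sum_i b i)]mul1r -w1 mulr_suml -sumrB.
apply: eq_bigr => i _; rewrite mxE ln_div ?posrE ?mulrBr//.
exact: sum_gt0 He _ b0.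
Qed.

(** [ln_add_ge] is used with [M = N] at each vertex, its error being exactly the change of the
    reciprocal term in [lyapunov]. For the total [T], [ln (T + N) <= ln T + N / T]. *)
Lemma lyapunov_step (w : 'rV[R]_m) (b xi : 'I_m -> R) : simplex w ->
  (forall i, 0 < b i) -> (forall i, 0 <= xi i <= N%:R) -> \sum_i xi i = N%:R ->
  lyapunov w (fun i => b i + xi i) <=
  lyapunov w b + N%:R / (\sum_i b i) - \sum_i w ord0 i * (xi i / b i).
Proof.
move=> sw b0 xi0 sxi; have [wp _] := sw.
have bx0 i : 0 < b i + xi i by rewrite ltr_pwDl//; have /andP[] := xi0 i.
have T0 := sum_gt0 He b0.
rewrite /lyapunov !entropy_partE// big_split/= sxi.
have hT : ln (\sum_i b i + N%:R) <= ln (\sum_i b i) + N%:R / \sum_i b i.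
  have -> : \sum_i b i + N%:R = (\sum_i b i) * (1 + N%:R / \sum_i b i).
    by rewrite mulrDr mulr1 mulrCA divff ?mulr1// gt_eqF.
  have NT : 0 <= N%:R / \sum_i b i by rewrite divr_ge0// ltW.
  rewrite lnM ?posrE ?ltr_pwDl// lerD2l le_ln1Dx//.
  by rewrite (lt_le_trans _ NT).
have hw : \sum_i w ord0 i * (xi i / b i - N%:R * ((b i)^-1 - (b i + xi i)^-1)) <=
    \sum_i w ord0 i * (ln (b i + xi i) - ln (b i)).
  by apply: ler_sum => i _; rewrite ler_wpM2l// ln_add_ge.
have E1 : \sum_i w ord0 i * (xi i / b i - N%:R * ((b i)^-1 - (b i + xi i)^-1)) =
    \sum_i w ord0 i * (xi i / b i) - N%:R * (\sum_i w ord0 i / b i)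
    + N%:R * (\sum_i w ord0 i / (b i + xi i)).
  rewrite !mulr_sumr -sumrB -big_split/=; apply: eq_bigr => i _; ring.
have E2 : \sum_i w ord0 i * (ln (b i + xi i) - ln (b i)) =
    \sum_i w ord0 i * ln (b i + xi i) - \sum_i w ord0 i * ln (b i).
  by rewrite -sumrB; apply: eq_bigr => i _; rewrite mulrBr.
move: hw; rewrite E1 E2; lra.
Qed.

(** * The urn as a process of histories *)

Let S : countType := {ffun 'I_m -> nat}.
Let C : finType := {ffun 'I_N -> 'I_m}.

Definition hist_head (hs : seq S) : S := head [ffun=> 0%N] hs.

Definition counts (b : S) : 'I_m -> R := fun i => (b i)%:R.

Definition urn_next (hs : seq S) (c : C) : S :=
  [ffun i => (hist_head hs i + #|[set k | c k == i]|)%N].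

(** Zero outside the hyperedge, so that choices range over all functions and [urn_prob] is a product
    law. *)
Definition choice_prob (b : S) (k : 'I_N) (j : 'I_m) : R :=
  if j \in e k then (b j)%:R / edge_weight e (counts b) k else 0.

Definition urn_prob (hs : seq S) (c : C) : R :=
  \prod_k choice_prob (hist_head hs) k (c k).

(** The initial state belongs to the history, so [(size hs).-1] steps have been made; the order in
    [sorted] is reversed because the newest state comes first. *)
Definition urn_good (n0 : nat) (hs : seq S) : bool :=
  [&& hs != [::], all (fun b : S => [forall i, (0 < b i)%N]) hs,
      (\sum_i hist_head hs i == n0 + (size hs).-1 * N)%N &
      sorted (fun b' b : S => [forall i, (b i <= b' i)%N]) hs].

Lemma urn_stepE (hs : seq S) (b' : S) :
  urn_step e (hist_head hs) b' = \sum_(c | urn_next hs c == b') urn_prob hs c.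
Proof.
rewrite /urn_step big_mkcond [RHS]big_mkcond; apply: eq_bigr => c _.
have -> : [forall i, b' i == (hist_head hs i + #|[set k | c k == i]|)%N] =
    (urn_next hs c == b').
  apply/forallP/eqP => [h|<- i]; last by rewrite ffunE.
  by apply/ffunP => i; rewrite ffunE; exact/esym/eqP.
case: (urn_next hs c == b'); last by rewrite andbF.
rewrite andbT; case: forallP => [h|/forallP].
  by apply: eq_bigr => k _; rewrite /choice_prob h.
rewrite negb_forall => /existsP[k /negbTE ck].
by rewrite /urn_prob (bigD1 k)//= /choice_prob ck mul0r.
Qed.

Variable n0 : nat.

Section Good.
Variable hs : seq S.
Hypothesis ghs : urn_good n0 hs.

Lemma urn_good_cons : hs = hist_head hs :: behead hs.
Proof. by case: hs ghs. Qed.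

Lemma urn_good_gt0 b : b \in hs -> forall i, 0 < counts b i.
Proof.
have /and4P[_ /allP h _ _] := ghs.
by move=> /h /forallP b0 i; rewrite ltr0n.
Qed.

Lemma urn_good_head_gt0 i : 0 < counts (hist_head hs) i.
Proof. by apply: urn_good_gt0; rewrite urn_good_cons mem_head. Qed.

Lemma choice_prob_sum k : \sum_j choice_prob (hist_head hs) k j = 1.
Proof.
rewrite -big_mkcond/= -mulr_suml divff// gt_eqF//.
exact: (edge_weight_gt0 He _ urn_good_head_gt0).
Qed.

Lemma urn_prob_ge0 c : 0 <= urn_prob hs c.
Proof.
apply: prodr_ge0 => k _; rewrite /choice_prob; case: ifP => // _.
rewrite divr_ge0// ltW//.
exact: (edge_weight_gt0 He _ urn_good_head_gt0).
Qed.

Lemma urn_prob_sum : \sum_c urn_prob hs c = 1.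
Proof.
rewrite /urn_prob -bigA_distr_bigA big1// => k _.
exact: choice_prob_sum.
Qed.

Lemma sum_card_preim (c : C) : (\sum_i #|[set k | c k == i]| = N)%N.
Proof.
transitivity (\sum_i \sum_(k | c k == i) 1)%N.
  apply: eq_bigr => i _; rewrite -sum1_card; apply: eq_bigl => k.
  by apply/idP/idP; rewrite inE.
by rewrite -[RHS]card_ord -sum1_card [RHS](partition_big c predT).
Qed.

Lemma urn_good_next c : urn_good n0 (urn_next hs c :: hs).
Proof.
have /and4P[_ h1 /eqP h2 h3] := ghs.
apply/and4P; split=> //=.
- rewrite h1 andbT; apply/forallP => i; rewrite ffunE ltn_addr//.
  by have := urn_good_head_gt0 i; rewrite ltr0n.
- rewrite /hist_head /= -/(hist_head _); under eq_bigr do rewrite ffunE.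
  rewrite big_split/= h2 sum_card_preim -addnA -mulSnr prednK//.
  by rewrite urn_good_cons.
- have pE (r : rel S) s x : sorted r s -> r x (hist_head s) -> path r x s.
    by case: s => //= y s -> ->.
  by apply: pE => //; apply/forallP => i; rewrite ffunE leq_addr.
Qed.

End Good.

(** [behead] restricts the drift sum to the states before the current one. It is formed with [w0]
    for every [w], since elements of J have the same edge weights and so the same drift. *)
Definition hist_lyapunov (w : 'rV[R]_m) (hs : seq S) : R :=
  lyapunov w (counts (hist_head hs)) +
  \sum_(b <- behead hs) drift e w0 (counts b).

Lemma hist_lyapunov_ge0 w hs : simplex w -> urn_good n0 hs ->
  0 <= hist_lyapunov w hs.
Proof.
move=> [wp _] ghs; have b0 := urn_good_head_gt0 ghs.
rewrite addr_ge0//.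
  rewrite subr_ge0 (le_trans (entropy_part_le0 He wp b0))//.
  by rewrite mulr_ge0// sumr_ge0// => i _; rewrite divr_ge0// ltW.
rewrite big_seq sumr_ge0// => b bh; apply: (drift_ge0 He) => // i.
apply: (urn_good_gt0 ghs).
exact: mem_behead.
Qed.

(** Hyperedge [k] picks [j] with probability proportional to [b_j], so the counts cancel in the mean
    of [w_j / b_j], which is the ratio of the edge weights of [w] and [b]. Summed over [k], this
    cancels the added drift and [N / T]. *)
Lemma hist_lyapunov_supermartingale w : same_edge_weights e w0 w ->
  supermartingale urn_next urn_prob (urn_good n0) (hist_lyapunov w).
Proof.
move=> [sw wE] hs ghs; set b := hist_head hs; set T := \sum_i counts b i.
have b0 := urn_good_head_gt0 ghs.
have step c : hist_lyapunov w (urn_next hs c :: hs) <= hist_lyapunov w hs +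
    (drift e w0 (counts b) + N%:R / T) - \sum_k w ord0 (c k) / counts b (c k).
  pose xi i : R := #|[set k | c k == i]|%:R.
  have cE : counts (hist_head (urn_next hs c :: hs)) = fun i => counts b i + xi i.
    by apply/funext => i; rewrite /counts /= ffunE natrD.
  rewrite /hist_lyapunov cE /= [X in \sum_(_ <- X) _](urn_good_cons ghs) big_cons.
  have xiN i : 0 <= xi i <= N%:R.
    by rewrite ler0n /= ler_nat (leq_trans (max_card _))// card_ord.
  have sxi : \sum_i xi i = N%:R by rewrite -natr_sum sum_card_preim.
  have := lyapunov_step sw b0 xiN sxi.
  have -> : \sum_i w ord0 i * (xi i / counts b i) =
      \sum_k w ord0 (c k) / counts b (c k).
    rewrite [RHS](partition_big c predT)//=; apply: eq_bigr => i _.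
    rewrite (eq_bigr (fun=> w ord0 i / counts b i)); last by move=> k /eqP ->.
    rewrite sumr_const -mulr_natr mulrA [LHS]mulrAC /xi.
    by congr (_ * _%:R); apply: eq_card => k; apply/idP/idP; rewrite inE.
  rewrite -/b -/T; lra.
apply: (@le_trans _ _ (\sum_c urn_prob hs c * (hist_lyapunov w hs +
    (drift e w0 (counts b) + N%:R / T) - \sum_k w ord0 (c k) / counts b (c k)))).
  by apply: ler_sum => c _; rewrite ler_wpM2l ?urn_prob_ge0.
under eq_bigr do rewrite mulrBr mulr_sumr.
rewrite sumrB -mulr_suml urn_prob_sum// mul1r exchange_big/=.
rewrite (eq_bigr (fun k => edge_weight e (w0 ord0) k / edge_weight e (counts b) k)).
  by rewrite /drift -/T subrK addrK.
move=> k _.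
rewrite (sum_prod_marginal (f := choice_prob b) (fun j => w ord0 j / counts b j));
  last exact: choice_prob_sum.
rewrite -wE /edge_weight mulr_suml [RHS]big_mkcond/=; apply: eq_bigr => j _.
rewrite /choice_prob; case: ifP => _; last by rewrite mul0r.
have bj : counts b j != 0 by rewrite gt_eqF.
have bk : edge_weight e (counts b) k != 0.
  by rewrite gt_eqF//; exact: (edge_weight_gt0 He _ b0).
rewrite -/(edge_weight _ _ _) -/(counts b j).
by field; rewrite bj bk.
Qed.


(** * Histories of a given urn process *)

Section UrnProcess.
Variables (d : measure_display) (T : measurableType d) (P : probability T R).
Variables (b0 : 'I_m -> nat) (B : nat -> T -> 'I_m -> nat).
Hypothesis b0_ge1 : forall i, (1 <= b0 i)%N.
Hypothesis HB : polya_urn_process P e b0 B.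

Definition urn_state n t : S := [ffun i => B n t i].

Fixpoint urn_hist n t : seq S :=
  if n is n'.+1 then urn_state n t :: urn_hist n' t else [:: urn_state 0 t].

Lemma size_urn_hist n t : size (urn_hist n t) = n.+1.
Proof. by elim: n => //= n ->. Qed.

Lemma hist_head_urn_hist n t : hist_head (urn_hist n t) = urn_state n t.
Proof. by case: n. Qed.

Lemma urn_stateP n t (b : S) : urn_state n t = b <-> forall i, B n t i = b i.
Proof.
split=> [<- i|h]; first by rewrite ffunE.
by apply/ffunP => i; rewrite ffunE.
Qed.

Lemma urn_histP n t (hs : seq S) : size hs = n.+1 -> urn_hist n t = hs <->
  forall k, (k <= n)%N -> forall i, B k t i = nth [ffun=> 0%N] hs (n - k) i.
Proof.
elim: n hs => [|n IH] [|b hs]//= [sz].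
  case: hs sz => //= _; split=> [[<-] k|h].
    by rewrite leqn0 => /eqP -> i; rewrite ffunE.
  by congr (_ :: _); apply/urn_stateP => i; rewrite h.
have nthS k : (k <= n)%N -> nth [ffun=> 0%N] (b :: hs) (n.+1 - k) =
    nth [ffun=> 0%N] hs (n - k) by move=> kn; rewrite subSn.
split=> [[bE /(IH _ sz) h] k|h].
  rewrite leq_eqVlt => /predU1P[-> i|]; first by rewrite subnn -bE ffunE.
  by rewrite ltnS => kn i; rewrite nthS// h.
congr (_ :: _); first by apply/urn_stateP => i; rewrite h// subnn.
by apply/(IH _ sz) => k kn i; rewrite h ?nthS// leqW.
Qed.

Lemma measurable_urn_hist n hs : measurable [set t | urn_hist n t = hs].
Proof.
have [Bm _ _] := HB.
have m1 k (b : S) : measurable [set t | urn_state k t = b].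
  rewrite (_ : mkset _ = [set t | forall i, B k t i = b i])//.
  by apply/seteqP; split=> t /urn_stateP.
elim: n hs => [|n IH] [|b hs].
- by rewrite (_ : mkset _ = set0)//; apply/seteqP; split.
- case: hs => [|b' hs].
    rewrite (_ : mkset _ = [set t | urn_state 0 t = b])//.
    by apply/seteqP; split=> t /= [->].
  by rewrite (_ : mkset _ = set0)//; apply/seteqP; split.
- by rewrite (_ : mkset _ = set0)//; apply/seteqP; split.
rewrite (_ : mkset _ = [set t | urn_state n.+1 t = b] `&` [set t | urn_hist n t = hs]).
  exact: measurableI.
by apply/seteqP; split=> t /= [-> ->].
Qed.

Lemma urn_hist_step n hs b : P [set t | urn_hist n.+1 t = b :: hs] =
  (P [set t | urn_hist n t = hs] *
   (\sum_(c | urn_next hs c == b) urn_prob hs c)%:E)%E.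
Proof.
have [_ _ Bstep] := HB.
(* For a list of the wrong length both events are empty. *)
have [sz|sz] := eqVneq (size hs) n.+1; last first.
  rewrite (_ : [set t | urn_hist n.+1 t = b :: hs] = set0); last first.
    by apply/seteqP; split=> t //= [_ h]; move: sz; rewrite -h size_urn_hist eqxx.
  rewrite (_ : [set t | urn_hist n t = hs] = set0) ?measure0 ?mul0e//.
  by apply/seteqP; split=> t //= h; move: sz; rewrite -h size_urn_hist eqxx.
have := Bstep n (fun k => nth [ffun=> 0%N] hs (n - k)) b.
rewrite subnn nth0 -/(hist_head hs) urn_stepE.
have -> : [set t | forall k, (k <= n)%N -> forall i,
    B k t i = nth [ffun=> 0%N] hs (n - k) i] = [set t | urn_hist n t = hs].
  by apply/seteqP; split=> t /=; rewrite urn_histP.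
move=> <-; congr (P _); apply/seteqP; split=> t /=.
  by move=> [/urn_stateP bE /(urn_histP _ sz) h].
by move=> [/(urn_histP _ sz) -> /urn_stateP ->].
Qed.

Lemma urn_hist0 : P [set t | urn_hist 0 t = [:: [ffun i => b0 i]]] = 1%E.
Proof.
have [_ <- _] := HB; congr (P _); apply/seteqP; split=> t /=.
  by move=> [/urn_stateP h] i; rewrite h ffunE.
by move=> h; congr [:: _]; apply/urn_stateP => i; rewrite h ffunE.
Qed.

Lemma urn_good0 : urn_good (\sum_i b0 i) [:: [ffun i => b0 i]].
Proof.
apply/and4P; split=> //=.
  by rewrite andbT; apply/forallP => i; rewrite ffunE.
rewrite mul0n addn0; apply/eqP; apply: eq_bigr => i _.
by rewrite ffunE.
Qed.

Lemma hist_lyapunov_sum w n t : hist_lyapunov w (urn_hist n t) =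
  lyapunov w (counts (urn_state n t)) +
  \sum_(k < n) drift e w0 (counts (urn_state k t)).
Proof.
rewrite /hist_lyapunov hist_head_urn_hist; congr (_ + _).
elim: n => [|n IH]; first by rewrite big_ord0 big_nil.
rewrite big_ord_recr/= -IH addrC.
by case: n {IH} => [|n] /=; rewrite big_cons.
Qed.

End UrnProcess.

End Urn.

(** * Almost sure convergence of the proportions *)

Lemma limit_set_cvg (R : realType) (m : nat) (u : nat -> 'rV[R]_m) (y : 'rV[R]_m) :
  u @ \oo --> y -> limit_set u `<=` [set y].
Proof.
move=> uy z uz; apply: (@norm_hausdorff _ 'rV[R]_m) => A U zA yU.
have [n0 _ Hn0] := uy U yU.
have [n n0n An] := uz A zA n0.
by exists (u n); split=> //; exact: Hn0.
Qed.

(** Chance enters only through two almost sure events: all histories are good, and the Lyapunov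
    expressions of the spanning list converge. On both, [urn_path_cvg] applies path by path. *)
Lemma urn_ae_cvg (R : realType) (m N : nat) (e : 'I_N -> {set 'I_m})
    (w0 : 'rV[R]_m) : hypergraph_ok e -> simplex w0 -> 0 < weight_product e w0 ->
  (forall x, simplex x -> weight_product e x <= weight_product e w0) ->
  forall (d : measure_display) (T : measurableType d) (P : probability T R)
    (b0 : 'I_m -> nat) (B : nat -> T -> 'I_m -> nat),
  (forall i, (1 <= b0 i)%N) -> polya_urn_process P e b0 B ->
  {ae P, forall t, exists2 y, same_edge_weights e w0 y &
    (urn_proportion N b0 (B n t) n : 'rV[R]_m) @[n --> \oo] --> y}.
Proof.
move=> He sw0 w00 w0m d T P b0 B b0_ge1 HB.
have Jw0 : same_edge_weights e w0 w0 by split.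
have [s [w0s sJ s_span]] := finite_spanning_subset Jw0.
pose n0 := (\sum_i b0 i)%N.
have mH := measurable_urn_hist HB.
have cH n t : exists s0, urn_hist B n.+1 t = s0 :: urn_hist B n t.
  by exists (urn_state B n.+1 t).
have p0 hs c := @urn_prob_ge0 R m N e He n0 hs ^~ c.
have p1 := @urn_prob_sum R m N e He n0.
have gn (hs : seq {ffun 'I_m -> nat}) (c : {ffun 'I_N -> 'I_m}) :
  urn_good N n0 hs -> urn_good N n0 (urn_next hs c :: hs).
  by move=> ghs; exact: (@urn_good_next R).
have g0 : urn_good N n0 [:: [ffun i => b0 i]] by exact: urn_good0.
have H0 := urn_hist0 HB.
have good := ae_good_history mH cH (urn_hist_step HB) gn g0 H0.
(* The index runs over all naturals to intersect countably many events; beyond the list the default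
   [w0] still lies in J. *)
have lyap : {ae P, forall t, forall j, exists l : R,
    hist_lyapunov e w0 (nth w0 s j) (urn_hist B n t) @[n --> \oo] --> l}.
  apply: ae_foralln => j.
  have Jj : same_edge_weights e w0 (nth w0 s j).
    have [js|sj] := ltnP j (size s); first by apply: sJ; exact: mem_nth.
    by rewrite nth_default.
  apply: (ae_supermartingale_cvg mH cH (urn_hist_step HB) p0 p1 gn g0 H0).
    exact: hist_lyapunov_supermartingale.
  by move=> hs; apply: hist_lyapunov_ge0 => //; have [] := Jj.
move: good lyap; apply: filterS2 => t good lyap.
pose b n : 'I_m -> R := counts R (urn_state B n t).
have b_gt0 n i : 0 < b n i.
  by have := urn_good_head_gt0 R (good n) i; rewrite hist_head_urn_hist.
have b_sum n : \sum_i b n i = n0%:R + n%:R * N%:R.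
  have /and4P[_ _ /eqP + _] := good n.
  rewrite hist_head_urn_hist size_urn_hist /= => h.
  by rewrite -natr_sum h natrD natrM.
have b_le n i : b n i <= b n.+1 i.
  have /and4P[_ _ _ /=] := good n.+1.
  case: n => [|n] /=; first by rewrite andbT ler_nat => /forallP.
  by move=> /andP[/forallP h _]; rewrite ler_nat.
have n0_gt0 : 0 < n0%:R :> R.
  have [N0 _ e0 _] := He; have [i _] := set0Pn _ (e0 (Ordinal N0)).
  by rewrite ltr0n /n0 (bigD1 i)//= ltn_addr// b0_ge1.
have s_cvg w : w \in s -> exists l : R,
    N%:R * (\sum_i w ord0 i / b n i) - entropy_part w (b n) +
    \sum_(k < n) drift e w0 (b k) @[n --> \oo] --> l.
  move=> ws; have [l Vl] := lyap (index w s); exists l.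
  move: Vl; rewrite nth_index//.
  by under eq_cvg do rewrite hist_lyapunov_sum.
have [y Jy xy] := urn_path_cvg He sw0 w00 w0m n0_gt0 b_gt0 b_sum b_le w0s
  s_span s_cvg.
exists y => //; move: xy.
have -> : (fun n => proportions (b n)) =
    (fun n => urn_proportion N b0 (B n t) n); last by [].
apply/funext => n; apply/rowP => i.
by rewrite !mxE b_sum /b /counts ffunE natrD natrM.
Qed.

Theorem theorem2 (R : realType) (m N : nat) (e : 'I_N -> {set 'I_m}) :
  hypergraph_ok e ->
  exists J : set 'rV[R]_m,
    [/\ closed J, connected J, J `<=` @simplex R m,
        (exists A : set 'rV[R]_m, affine_subspace A /\ J `<=` A)
      & forall (d : measure_display) (T : measurableType d)
               (P : probability T R) (b0 : 'I_m -> nat)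
               (B : nat -> T -> 'I_m -> nat),
          (forall i, (1 <= b0 i)%N) ->
          polya_urn_process P e b0 B ->
          let x := fun t n => urn_proportion (R := R) N b0 (B n t) n in
          {ae P, forall t, limit_set (x t) `<=` J} /\
          ({ae P, forall t, limit_set (x t) `&` @simplex_boundary R m = set0} ->
           {ae P, forall t, exists2 y, J y & x t @ \oo --> y})].
Proof.
move=> He; have [w0 [sw0 w00 w0m]] := weight_product_max R He.
exists (same_edge_weights e w0); split.
- exact: closed_same_edge_weights.
- exact: connected_same_edge_weights.
- by move=> x [].
- exists [set x : 'rV[R]_m |
    forall k, edge_weight e (x ord0) k = edge_weight e (w0 ord0) k].
  by split=> [|x []//]; exact: affine_same_edge_weights.
move=> d T P b0 B b0_ge1 HB x.
have cvg_x := urn_ae_cvg He sw0 w00 w0m b0_ge1 HB.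
split=> //; move: cvg_x; apply: filterS => t [y Jy xy] z zx.
by rewrite (limit_set_cvg xy zx).
Qed.
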